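(* For any $\lambda<1$ and $\epsilon>0$ there exist $n,d,k$ and $A\in\mathbb{R}^{n\times d}$ such that, with $m=\lceil k/\epsilon\rceil$, letting $\tilde P$ be the $k$-cluster projection matrix minimizing $\|A_m-PA_m\|_F^2$ and $P^*$ the $k$-cluster projection matrix minimizing $\|A-PA\|_F^2$, $$\|A-\tilde PA\|_F^2>(1+\epsilon)\lambda\|A-P^*A\|_F^2.$$
   Context: $A_m$ is the best rank $m$ approximation of $A$ (truncated SVD keeping the top $m$ singular values). For a partition $C=\{C_1,\dots,C_k\}$ of the row indices of $A$ into $k$ clusters, the cluster indicator matrix $X_C\in\mathbb{R}^{n\times k}$ has $X_C(i,j)=1/\sqrt{|C_j|}$ if row $i\in C_j$ and $0$ otherwise; $X_CX_C^\top$ is called a $k$-cluster projection matrix, and $\|A-X_CX_C^\top A\|_F^2$ is the $k$-means cost of the clustering $C$. *)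

(* Defs.v *)
From mathcomp Require Import all_boot all_order all_algebra.
From mathcomp Require Import reals.

Set Implicit Arguments.
Unset Strict Implicit.
Unset Printing Implicit Defensive.

Import Order.TTheory GRing.Theory Num.Theory.
Local Open Scope ring_scope.

Definition frobenius (R : realType) (n d : nat) (A : 'M[R]_(n, d)) : R :=
  Num.sqrt (\sum_i \sum_j A i j ^+ 2).

(* Compact form A = U diag(s) V^T: since the entries of s are positive,
   r is necessarily the rank of A. *)
Definition is_svd (R : realType) (n d r : nat) (A : 'M[R]_(n, d))
    (U : 'M[R]_(n, r)) (s : 'rV[R]_r) (V : 'M[R]_(d, r)) : Prop :=
  [/\ U^T *m U = 1%:M,
      V^T *m V = 1%:M,
      forall j : 'I_r, 0 < s 0 j,
      forall i j : 'I_r, (i <= j)%N -> s 0 j <= s 0 i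
    & A = U *m diag_mx s *m V^T].

(* A relation rather than a function: A_m depends on the chosen SVD when the
   m-th and (m+1)-st singular values coincide.  It equals A if m >= rank A. *)
Definition truncated_svd (R : realType) (n d m : nat)
    (A Am : 'M[R]_(n, d)) : Prop :=
  exists (r : nat) (U : 'M[R]_(n, r)) (s : 'rV[R]_r) (V : 'M[R]_(d, r)),
    is_svd A U s V /\
    Am = U *m diag_mx (\row_(j < r) if (j < m)%N then s 0 j else 0) *m V^T.

(* [partition] makes the clusters nonempty, disjoint and covering; injectivity
   makes the k clusters pairwise distinct. *)
Definition is_clustering (n k : nat) (C : 'I_k -> {set 'I_n}) : Prop :=
  injective C /\ partition [set C j | j : 'I_k] [set: 'I_n].

Definition indicator_mx (R : realType) (n k : nat) (C : 'I_k -> {set 'I_n}) :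
    'M[R]_(n, k) :=
  \matrix_(i < n, j < k) if i \in C j then 1 / Num.sqrt #|C j|%:R else 0.

Definition cluster_proj (R : realType) (n k : nat) (P : 'M[R]_n) : Prop :=
  exists C : 'I_k -> {set 'I_n},
    is_clustering C /\ P = indicator_mx R C *m (indicator_mx R C)^T.

Definition kmeans_cost (R : realType) (n d : nat) (A : 'M[R]_(n, d))
    (P : 'M[R]_n) : R :=
  frobenius (A - P *m A) ^+ 2.

Definition optimal_cluster_proj (R : realType) (n d k : nat)
    (A : 'M[R]_(n, d)) (P : 'M[R]_n) : Prop :=
  cluster_proj k P /\
  forall Q : 'M[R]_n, cluster_proj k Q -> kmeans_cost A P <= kmeans_cost A Q.

(* Main.v *)
Require Import Defs.
From mathcomp Require Import all_boot all_order all_algebra.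
From mathcomp Require Import reals.
From mathcomp Require Import ring lra.

(* The matrix is block diagonal. The first block has m orthogonal columns, each
   carried by its own rows with entries 1/sqrt 1, ..., 1/sqrt N; the second one
   is tau times the identity of size k - 1, with tau^2 = H - 1, where
   H = 1 + 1/2 + ... + 1/N is the squared norm of a column of the first block.
   Hence the best rank m approximation erases the second block.
   A cluster of size t sums to at most 2 sqrt t in the entries 1/sqrt b, so a
   k-clustering captures at most 4k of the first block's squared norm mH. Giving
   each row of the second block its own cluster costs at most mH. In an optimal
   clustering of the rank m approximation equal rows lie in the same cluster, so
   the erased rows are together and at most tau^2 of the second block is
   captured: the cost on the full matrix is at least mH + (k - 2)(H - 1) - 4k.
   The ratio tends to (m + k - 2) / m as N grows, and to 1 + eps as k grows. *)

Set Implicit Arguments.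
Unset Strict Implicit.
Unset Printing Implicit Defensive.

Import Order.TTheory GRing.Theory Num.Theory.
Local Open Scope ring_scope.

(** * Clusterings as surjective assignments of rows to clusters, and their costs *)

Section Assignments.
Variables (R : realType) (n d k : nat).
Implicit Types (A : 'M[R]_(n, d)) (f g : {ffun 'I_n -> 'I_k}).
Implicit Types (mu : 'I_k -> 'I_d -> R).

Definition onto f := [forall j, exists i, f i == j].

Lemma ontoP f : reflect (forall j, exists i, f i = j) (onto f).
Proof.
apply: (iffP forallP) => onto_f j.
  by have /existsP[i /eqP] := onto_f j; exists i.
by have [i fij] := onto_f j; apply/existsP; exists i; apply/eqP.
Qed.

Definition fiber f j := [set i | f i == j].

Lemma mem_fiber f i : i \in fiber f (f i).
Proof. by rewrite inE. Qed.

Lemma card_fiber_gt0 f i : (0 < #|fiber f (f i)|)%N.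
Proof. by apply/card_gt0P; exists i; apply: mem_fiber. Qed.

Lemma card_fiber f j : (#|fiber f j|%:R : R) = \sum_(i | f i == j) 1.
Proof. by rewrite sumr_const; congr (_ *+ _); apply: eq_card => i; rewrite inE. Qed.

Lemma fiber_clustering f : onto f -> is_clustering (fiber f).
Proof.
move=> /ontoP onto_f; split.
  move=> j j' eq_jj'; have [i fij] := onto_f j.
  by apply/esym; have := mem_fiber f i; rewrite fij eq_jj' inE fij => /eqP.
apply/and3P; split.
- rewrite eqEsubset subsetT /=; apply/subsetP => i _.
  apply/bigcupP; exists (fiber f (f i)); last by rewrite inE.
  by apply/imsetP; exists (f i).
- apply/trivIsetP => _ _ /imsetP[j _ ->] /imsetP[j' _ ->] neq.
  rewrite -setI_eq0; apply/eqP/setP => i; rewrite !inE.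
  apply/negbTE/negP => /andP[/eqP fij /eqP fij'].
  by rewrite -fij -fij' eqxx in neq.
- apply/negP => /imsetP[j _ e0]; have [i fij] := onto_f j.
  by have := in_set0 i; rewrite e0 inE fij eqxx.
Qed.

Lemma clustering_fiber (C : 'I_k -> {set 'I_n}) :
  is_clustering C -> exists2 f, onto f & C =1 fiber f.
Proof.
case=> injC /and3P[/eqP covC trivC n0C].
have cov i : exists j, i \in C j.
  have : i \in cover [set C j | j : 'I_k] by rewrite covC inE.
  by case/bigcupP=> _ /imsetP[j _ ->] ?; exists j.
have uniqC i j j' : i \in C j -> i \in C j' -> j = j'.
  move=> iCj iCj'; apply: injC; apply/eqP/negP => /negP neq.
  have /trivIsetP/(_ (C j) (C j')) := trivC.
  rewrite !imset_f // => /(_ isT isT neq)/pred0P/(_ i) /=.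
  by rewrite iCj iCj'.
have [f fP] := fin_all_exists cov.
exists (finfun f).
  apply/ontoP => j; have /set0Pn[i iCj] : C j != set0.
    by apply: contraNneq n0C => <-; apply: imset_f.
  by exists i; rewrite ffunE; apply: uniqC iCj.
move=> j; apply/setP => i; rewrite inE ffunE.
by apply/idP/eqP => [iCj|<- //]; apply: uniqC iCj.
Qed.

Definition proj_of f : 'M[R]_n :=
  indicator_mx R (fiber f) *m (indicator_mx R (fiber f))^T.

Lemma cluster_projP (P : 'M[R]_n) :
  cluster_proj k P <-> exists2 f, onto f & P = proj_of f.
Proof.
split=> [[C [/clustering_fiber[f onto_f eqC] ->]]|[f onto_f ->]].
  exists f => //; rewrite /proj_of.
  suff -> : indicator_mx R C = indicator_mx R (fiber f) by [].
  by apply/matrixP => i j; rewrite !mxE eqC.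
by exists (fiber f); split=> //; apply: fiber_clustering.
Qed.

(** An empty fiber gets the value 0, by the convention on division by zero. *)
Definition mean A f j l : R := (\sum_(i | f i == j) A i l) / #|fiber f j|%:R.

Definition sqdist A i (c : 'I_d -> R) : R := \sum_l (A i l - c l) ^+ 2.

(** The centers [mu] are arbitrary, so that an assignment can be tested against centers other than
    its means. *)
Definition wcss A f mu : R := \sum_i sqdist A i (mu (f i)).

Definition kcost A f : R := wcss A f (mean A f).

Lemma sqdist_ge0 A i c : 0 <= sqdist A i c.
Proof. by apply: sumr_ge0 => l _; apply: sqr_ge0. Qed.

Lemma sqdist_eq0 A i c : sqdist A i c = 0 -> forall l, A i l = c l.
Proof.
move=> /eqP; rewrite psumr_eq0 => [/allP h l|l _]; last exact: sqr_ge0.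
have := h l (mem_index_enum l).
by rewrite /= sqrf_eq0 subr_eq0 => /eqP.
Qed.

Lemma proj_of_mul A f i l : (proj_of f *m A) i l = mean A f (f i) l.
Proof.
rewrite mxE /mean big_distrl [RHS]big_mkcond /=; apply: eq_bigr => i' _.
rewrite mxE (bigD1 (f i)) //= big1 ?addr0 => [|j /negbTE nj]; last first.
  by rewrite !mxE inE eq_sym nj mul0r.
rewrite !mxE !inE eqxx; case: eqP => [_|_]; last by rewrite mulr0 mul0r.
by rewrite !div1r -invfM -expr2 sqr_sqrtr ?ler0n // mulrC.
Qed.

Lemma kmeans_cost_proj_of A f : kmeans_cost A (proj_of f) = kcost A f.
Proof.
rewrite /kmeans_cost /frobenius sqr_sqrtr; last first.
  by apply: sumr_ge0 => i _; apply: sumr_ge0 => l _; apply: sqr_ge0.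
apply: eq_bigr => i _; apply: eq_bigr => l _.
by rewrite 2!mxE -/(_ *m _) [in X in _ - X]proj_of_mul.
Qed.

Lemma optimal_cluster_projP A P :
  optimal_cluster_proj k A P <->
  exists f, [/\ onto f, P = proj_of f &
                forall g, onto g -> kcost A f <= kcost A g].
Proof.
split=> [[/cluster_projP[f onto_f ->] optf]|[f [onto_f -> optf]]].
  exists f; split=> // g onto_g; rewrite -!kmeans_cost_proj_of; apply: optf.
  by apply/cluster_projP; exists g.
split; first by apply/cluster_projP; exists f.
by move=> Q /cluster_projP[g onto_g ->]; rewrite !kmeans_cost_proj_of optf.
Qed.

Lemma optimal_cluster_proj_exists A g :
  onto g -> exists P, optimal_cluster_proj k A P.
Proof.
move=> onto_g.
have [f onto_f optf] := arg_minP (kcost A) onto_g.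
by exists (proj_of f); apply/optimal_cluster_projP; exists f.
Qed.

(** Deviations from the mean sum to 0, so the cross term vanishes. *)
Lemma sum_sqr_sub (I : finType) (P : pred I) (x : I -> R) (c : R) :
  let m := (\sum_(i | P i) x i) / (\sum_(i | P i) 1) in
  \sum_(i | P i) (x i - c) ^+ 2 =
    \sum_(i | P i) (x i - m) ^+ 2 + (\sum_(i | P i) 1) * (c - m) ^+ 2.
Proof.
move=> m.
have mE : \sum_(i | P i) (x i - m) = 0.
  rewrite sumrB sumr_const -[m *+ _]mulr_natl /m !sumr_const.
  have [e0|n0] := eqVneq #|P|%:R (0 : R); last by rewrite mulrC divfK ?subrr.
  rewrite e0 mul0r subr0; move/eqP: e0; rewrite pnatr_eq0 => /eqP/card0_eq e0.
  by rewrite big_pred0.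
transitivity (\sum_(i | P i) ((x i - m) ^+ 2 + 1 * (c - m) ^+ 2 +
                            2 * (m - c) * (x i - m))).
  by apply: eq_bigr => i _; ring.
by rewrite !big_split -!big_distrl -big_distrr /= mE mulr0 addr0.
Qed.

Lemma wcss_kcost A f mu :
  wcss A f mu = kcost A f +
    \sum_j \sum_l #|fiber f j|%:R * (mu j l - mean A f j l) ^+ 2.
Proof.
have byfiber nu :
    wcss A f nu = \sum_j \sum_l \sum_(i | f i == j) (A i l - nu j l) ^+ 2.
  rewrite /wcss (partition_big f xpredT) //=; apply: eq_bigr => j _.
  by rewrite [RHS]exchange_big /=; apply: eq_bigr => i /eqP <-.
rewrite /kcost !byfiber -big_split; apply: eq_bigr => j _ /=.
rewrite -big_split; apply: eq_bigr => l _ /=.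
by rewrite /mean card_fiber; apply: sum_sqr_sub.
Qed.

Lemma kcost_le_wcss A f mu : kcost A f <= wcss A f mu.
Proof.
rewrite wcss_kcost lerDl; apply: sumr_ge0 => j _; apply: sumr_ge0 => l _.
by rewrite mulr_ge0 ?ler0n ?sqr_ge0.
Qed.

Lemma kcost_ge0 A f : 0 <= kcost A f.
Proof. by apply: sumr_ge0 => i _; apply: sqdist_ge0. Qed.

(** A row alone in its cluster coincides with the mean. *)
Lemma exists_cluster_mate A f i :
  sqdist A i (mean A f (f i)) != 0 -> exists2 i', i' != i & f i' = f i.
Proof.
move=> dist0.
have [/existsP[i' /andP[? /eqP]]|] := boolP [exists i', (i' != i) && (f i' == f i)].
  by exists i'.
rewrite negb_exists => /forallP alone.
have eqi i' : (f i' == f i) = (i' == i).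
  have := alone i'; case: (eqVneq i' i) => [->|_]; first by rewrite eqxx.
  by rewrite andTb => /negbTE.
case/eqP: dist0; apply: big1 => l _.
by rewrite /mean card_fiber !(big_pred1 i) // divr1 subrr expr0n.
Qed.

(* Moving one of the two rows to the other's cluster is free for the old
   centers but displaces a mean, unless both rows are their own means; in that
   case merging the two clusters frees one for a row that is not. *)
Lemma optimal_eq_rows A f i1 i2 :
    onto f -> (forall g, onto g -> kcost A f <= kcost A g) ->
    0 < kcost A f -> (forall l, A i1 l = A i2 l) ->
  f i1 = f i2.
Proof.
move=> /ontoP onto_f opt_f cost_gt0.
have dist_row i i' c : (forall l, A i l = A i' l) -> sqdist A i c = sqdist A i' c.
  by move=> e; apply: eq_bigr => l _; rewrite e.
pose D i i' := sqdist A i (mean A f (f i')).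
(* The rows being equal, one of the two centers is at least as close to both; [i2] names the row
   assigned to it. *)
wlog le21 : i1 i2 / D i1 i2 <= D i1 i1.
  move=> H e; case/orP: (le_total (D i1 i2) (D i1 i1)) => le; first exact: H.
  apply/esym/H => [|l]; last by rewrite e.
  by rewrite /D -!(dist_row i1 i2).
move=> eq12; apply/eqP/negP => /negP neq.
have [D0|Dn0] := eqVneq (D i1 i1) 0; last first.
  (* Row [i1] joins the cluster of [i2]; its mate [i'] keeps the old cluster nonempty. *)
  pose g := [ffun x => if x == i1 then f i2 else f x].
  have [i' ni' fi'] := exists_cluster_mate Dn0.
  have onto_g : onto g.
    apply/ontoP => j; have [x fx] := onto_f j.
    have [xi|nx] := eqVneq x i1; last by exists x; rewrite ffunE (negbTE nx).
    by exists i'; rewrite ffunE (negbTE ni') fi' -xi.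
  have le_gf : wcss A g (mean A f) <= kcost A f.
    apply: ler_sum => x _; rewrite ffunE; case: eqP => [->|//]; exact: le21.
  (* Optimality of [f] rules out any gain from recomputing the means of [g]. *)
  have : \sum_j \sum_l #|fiber g j|%:R * (mean A f j l - mean A g j l) ^+ 2 <= 0.
    have := opt_f _ onto_g; rewrite wcss_kcost in le_gf; lra.
  set S := (X in X <= 0) => Sle0.
  have S0 : S = 0.
    apply/eqP; rewrite eq_le Sle0 /=.
    by do 2!apply: sumr_ge0 => ? _; rewrite mulr_ge0 ?ler0n ?sqr_ge0.
  have mean_eq l : mean A f (f i1) l = mean A g (f i1) l.
    move/eqP: S0; rewrite psumr_eq0 => [/allP h|j _]; last first.
      by apply: sumr_ge0 => ? _; rewrite mulr_ge0 ?ler0n ?sqr_ge0.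
    have := h (f i1) (mem_index_enum _).
    rewrite /= psumr_eq0 => [/allP/(_ l (mem_index_enum _))|? _]; last first.
      by rewrite mulr_ge0 ?ler0n ?sqr_ge0.
    rewrite /= mulf_eq0 sqrf_eq0 subr_eq0 => /orP[|/eqP //].
    rewrite pnatr_eq0 => /eqP e0.
    have : (0 < #|fiber g (g i')|)%N by apply: card_fiber_gt0.
    by rewrite ffunE (negbTE ni') fi' e0.
  have sum_fg (F : 'I_n -> R) :
      \sum_(i | f i == f i1) F i = F i1 + \sum_(i | g i == f i1) F i.
    rewrite (bigD1 i1) //=; congr (_ + _); apply: eq_bigl => x.
    rewrite ffunE; case: (eqVneq x i1) => _; last by rewrite andbT.
    by rewrite andbF eq_sym (negbTE neq).
  have g0 : #|fiber g (f i1)|%:R != 0 :> R.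
    rewrite pnatr_eq0 -lt0n.
    have := card_fiber_gt0 g i'; by rewrite ffunE (negbTE ni') fi'.
  have f0 : #|fiber f (f i1)|%:R != 0 :> R.
    by rewrite pnatr_eq0 -lt0n card_fiber_gt0.
  (* Removing row [i1] left the mean of its old cluster unchanged, so the row equals that mean,
     against [Dn0]. *)
  case/eqP: Dn0; apply: big1 => l _; apply/eqP; rewrite sqrf_eq0 subr_eq0.
  have := mean_eq l; rewrite /mean.
  have cE : #|fiber f (f i1)|%:R = 1 + #|fiber g (f i1)|%:R :> R.
    by rewrite !card_fiber sum_fg.
  rewrite sum_fg; move: cE f0 g0.
  set a := #|fiber f _|%:R; set b := #|fiber g _|%:R.
  move=> cE f0 g0.
  set s := \sum_(i | g i == _) _ => e.
  apply/eqP; rewrite e.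
  have : (A i1 l + s) * b = s * a.
    by rewrite -[s in RHS](divfK g0) -e; field; rewrite f0.
  rewrite cE => h; apply: (mulIf g0); rewrite divfK //; lra.
have D120 : D i1 i2 = 0.
  by apply/eqP; rewrite eq_le -{1}D0 le21 sqdist_ge0.
have [i Di] : exists i, D i i != 0.
  have [/existsP //|] := boolP [exists i, D i i != 0].
  rewrite negb_exists => /forallP h.
  move: cost_gt0; rewrite /kcost /wcss big1 ?ltxx // => x _.
  by have := h x; rewrite negbK => /eqP.
have ni1 : i1 != i by apply: contraNneq Di => <-; rewrite D0.
have [i' ni' fi'] := exists_cluster_mate Di.
(* The cluster of [i2] merges into that of [i1], both centers being the common row. The freed label
   goes to [i] alone, with row [i] as center. *)
pose g := [ffun x => if x == i then f i2 else if f x == f i2 then f i1 else f x].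
pose mu j l := if j == f i2 then A i l else mean A f j l.
have onto_g : onto g.
  apply/ontoP => j.
  have [->|nj2] := eqVneq j (f i2); first by exists i; rewrite ffunE eqxx.
  have [->|nj1] := eqVneq j (f i1).
    by exists i1; rewrite ffunE (negbTE ni1) (negbTE neq).
  have [x fx] := onto_f j; have [xi|nx] := eqVneq x i.
    exists i'; rewrite ffunE (negbTE ni') fi' -xi fx (negbTE nj2) //.
  by exists x; rewrite ffunE (negbTE nx) fx (negbTE nj2).
have := le_trans (opt_f _ onto_g) (kcost_le_wcss A g mu).
rewrite leNgt => /negP[].
rewrite /wcss (bigD1 i) //= /kcost /wcss [ltRHS](bigD1 i) //=.
(* The cost of row [i] drops to 0 from a positive value; the other rows keep theirs. *)
apply: ltr_leD.
  rewrite {1}/sqdist big1 ?lt0r ?sqdist_ge0 ?andbT // => l _.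
  by rewrite ffunE eqxx /mu eqxx subrr expr0n.
apply: ler_sum => x nx; rewrite ffunE (negbTE nx) le_eqVlt; apply/orP; left.
apply/eqP; apply: eq_bigr => l _; rewrite /mu.
have [fx|nfx] := eqVneq (f x) (f i2); last by rewrite (negbTE nfx).
by rewrite (negbTE neq) fx -(sqdist_eq0 D0) -(sqdist_eq0 D120).
Qed.

(** Pythagoras, from [wcss_kcost] with all centers 0; the subtracted sum is the squared norm of the
    projected matrix. *)
Lemma kcost_captured A f :
  kcost A f = \sum_i \sum_l A i l ^+ 2 -
    \sum_l \sum_j #|fiber f j|%:R * mean A f j l ^+ 2.
Proof.
apply/eqP; rewrite eq_sym subr_eq [X in _ + X]exchange_big /=.
have <- : wcss A f (fun _ _ => 0) = \sum_i \sum_l A i l ^+ 2.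
  by apply: eq_bigr => i _; apply: eq_bigr => l _; rewrite subr0.
rewrite wcss_kcost; apply/eqP; congr (_ + _).
by apply: eq_bigr => j _; apply: eq_bigr => l _; rewrite sub0r sqrrN.
Qed.

End Assignments.

(** * Truncated SVD of matrices with diagonal Gram matrix *)

Lemma card_ord_ltn r m : (m <= r)%N -> #|[set i : 'I_r | (i < m)%N]| = m.
Proof.
move=> le_mr; rewrite -sum1_card (eq_bigl (fun i : 'I_r => i < m)%N).
  by rewrite -(big_ord_widen _ (fun=> 1%N) le_mr) sum1_card card_ord.
by move=> i; rewrite inE.
Qed.

Section TruncatedSVD.
Variables (R : realType).

(* If A^T A = tau + E with E a diagonal 0/1 matrix, then in any SVD the matrix
   diag(s^2) - tau = V^T E V is again a diagonal idempotent, so it selects the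
   leading tr E singular values. *)
Lemma truncated_svd_two_values n d m (A Am : 'M[R]_(n, d)) (tau : R) :
    0 < tau -> (m <= d)%N ->
    A^T *m A = diag_mx (\row_(j < d) (tau + (j < m)%:R)) ->
    truncated_svd m A Am ->
  Am = A *m diag_mx (\row_(j < d) (j < m)%:R).
Proof.
move=> tau0 le_md AtA [r [U [s [V [[UU VV s0 s_dec AE] ->]]]]].
set E := diag_mx (\row_(j < d) (j < m)%:R).
have DE : A^T *m A = tau%:M + E.
  rewrite AtA -diag_const_mx -raddfD /=; congr diag_mx.
  by apply/rowP => j; rewrite !mxE.
have VSV : A^T *m A = V *m diag_mx (\row_j s 0 j ^+ 2) *m V^T.
  rewrite {1}AE AE !trmx_mul trmxK tr_diag_mx.
  rewrite -!mulmxA (mulmxA U^T) UU mul1mx (mulmxA (diag_mx s)) mulmx_diag.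
  by congr (_ *m (diag_mx _ *m _)); apply/rowP => j; rewrite !mxE expr2.
(* The Gram matrix is invertible since [tau] is positive, and left multiplication by [V *m V^T]
   fixes it. *)
have VVt : V *m V^T = 1%:M.
  have Du : A^T *m A \in unitmx.
    rewrite AtA unitmxE det_diag unitfE; apply/prodf_neq0 => j _.
    by rewrite mxE gt_eqF // ltr_wpDr ?ler0n.
  have : V *m V^T *m (A^T *m A) = A^T *m A.
    by rewrite VSV -!mulmxA (mulmxA V^T) VV mul1mx.
  by move/(congr1 (mulmx^~ (invmx (A^T *m A)))); rewrite mulmxK // mulmxV.
have EE : E *m E = E.
  rewrite mulmx_diag; congr diag_mx; apply/rowP => j; rewrite !mxE.
  by case: (j < m)%N; rewrite ?mulr1 ?mulr0.
pose c j := s 0 j ^+ 2 - tau.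
have VEV : V^T *m E *m V = diag_mx (\row_j c j).
  have -> : E = A^T *m A - tau%:M by rewrite DE addrC addKr.
  rewrite VSV mulmxBr mulmxBl !mulmxA VV mul1mx -mulmxA VV mulmx1.
  rewrite mul_mx_scalar -scalemxAl VV scalemx1 -diag_const_mx -raddfB.
  by congr diag_mx; apply/rowP => j; rewrite !mxE.
have cc j : c j = (c j == 1)%:R.
  have : diag_mx (\row_j c j) *m diag_mx (\row_j c j) = diag_mx (\row_j c j).
    rewrite -VEV -!mulmxA (mulmxA V) VVt mul1mx (mulmxA E) EE //.
  rewrite mulmx_diag => /matrixP/(_ j j); rewrite !mxE eqxx !mulr1n.
  move: (c j) => x /eqP.
  rewrite -subr_eq0 -[X in _ - X]mulr1 -mulrBr mulf_eq0 subr_eq0.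
  by case/orP=> /eqP ->; rewrite ?eqxx // eq_sym oner_eq0.
pose J := [set j | c j == 1].
(* The trace of [V^T *m E *m V] is that of [E], namely [m], and counts the elements of [J]. *)
have cardJ : #|J| = m.
  apply/eqP; rewrite -(eqr_nat R) -sumr_const.
  have : \tr (V^T *m E *m V) = m%:R.
    rewrite -mulmxA mxtrace_mulC -mulmxA VVt mulmx1 mxtrace_diag.
    transitivity (\sum_(j in [set j : 'I_d | (j < m)%N]) (1 : R)).
      rewrite [RHS]big_mkcond; apply: eq_bigr => j _.
      by rewrite mxE inE; case: (j < m)%N.
    by rewrite sumr_const card_ord_ltn.
  rewrite VEV mxtrace_diag => <-; apply/eqP; rewrite big_mkcond.
  by apply: eq_bigr => j _; rewrite mxE inE [RHS]cc; case: (c j == 1).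
(* Since [s] decreases, [J] is an initial segment, hence the first [m] indices. *)
have Jdown (i j : 'I_r) : (i <= j)%N -> j \in J -> i \in J.
  move=> le_ij; rewrite !inE => /eqP cj.
  have : c j <= c i by rewrite lerD2r ler_sqr ?nnegrE ?(ltW (s0 _)) ?s_dec.
  by rewrite cj (cc i); case: (c i == 1); rewrite // ler10.
have JE (j : 'I_r) : (j < m)%N = (j \in J).
  apply/idP/idP => [lt_jm|jJ].
    apply: contraLR lt_jm => jJ; rewrite -leqNgt -cardJ.
    have sub : J \subset [set i : 'I_r | (i < j)%N].
      apply/subsetP => i iJ; rewrite inE ltnNge; apply: contra jJ => le_ji.
      exact: Jdown iJ.
    apply: leq_trans (subset_leq_card sub) _.
    by rewrite card_ord_ltn // ltnW.
  rewrite -cardJ -[X in (X <= _)%N](card_ord_ltn (ltn_ord j)).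
  apply: subset_leq_card; apply/subsetP => i; rewrite inE ltnS => le_ij.
  exact: Jdown jJ.
have -> : diag_mx (\row_j (if (j < m)%N then s 0 j else 0)) =
          diag_mx s *m diag_mx (\row_j c j).
  rewrite mulmx_diag; congr diag_mx; apply/rowP => j; rewrite !mxE.
  by rewrite cc JE inE; case: (c j == 1); rewrite ?mulr1 ?mulr0.
have -> : U *m (diag_mx s *m diag_mx (\row_j c j)) *m V^T
        = A *m V *m diag_mx (\row_j c j) *m V^T.
  by rewrite {1}AE -!mulmxA (mulmxA V^T) VV mul1mx.
rewrite -VEV -!mulmxA (mulmxA V) VVt mul1mx mulmx1.
by [].
Qed.

(** The columns of [A] are orthogonal, so normalising them gives [U], with [V] the identity. *)
Lemma truncated_svd_exists n d m (A : 'M[R]_(n, d)) (t : 'rV[R]_d) :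
    (forall j, 0 < t 0 j) -> (forall i j : 'I_d, (i <= j)%N -> t 0 j <= t 0 i) ->
    A^T *m A = diag_mx t ->
  exists Am, truncated_svd m A Am.
Proof.
move=> t0 t_dec AtA.
pose s : 'rV[R]_d := \row_j Num.sqrt (t 0 j).
have s0 j : 0 < s 0 j by rewrite mxE sqrtr_gt0.
eexists; exists d, (A *m diag_mx (\row_j (s 0 j)^-1)), s, 1%:M.
split; last by [].
split=> //.
- rewrite trmx_mul tr_diag_mx -!mulmxA (mulmxA A^T) AtA !mulmx_diag.
  rewrite -diag_const_mx; congr diag_mx; apply/rowP => j; rewrite !mxE.
  have := sqr_sqrtr (ltW (t0 j)); have := s0 j; rewrite mxE.
  by move: (Num.sqrt _) => x x0 <-; field; rewrite gt_eqF.
- by rewrite trmx1 mulmx1.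
- by move=> i j /t_dec le_t; rewrite !mxE ler_wsqrtr.
- rewrite trmx1 mulmx1 -mulmxA mulmx_diag -[LHS]mulmx1 -diag_const_mx.
  congr (_ *m diag_mx _); apply/rowP => j; rewrite !mxE mulVf //.
  by have := s0 j; rewrite mxE => sj; rewrite gt_eqF.
Qed.

End TruncatedSVD.

(** * Harmonic sums and sums of inverse square roots *)

Section Harmonic.
Variable R : realType.

Definition harmonic_sum N : R := \sum_(b < N) b.+1%:R^-1.

(** Passing from [N] to [2N] adds [N] terms, each at least 1/(2N), hence at least 1/2. *)
Lemma harmonic_unbounded (M : R) : exists2 N, (0 < N)%N & M < harmonic_sum N.
Proof.
have H p : exists2 N, (0 < N)%N & p%:R / 2 <= harmonic_sum N.
  elim: p => [|p [N N0 IH]].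
    by exists 1%N => //; rewrite mul0r; apply: sumr_ge0 => b _; rewrite invr_ge0 ler0n.
  exists (N + N)%N; first by rewrite addn_gt0 N0.
  rewrite /harmonic_sum big_split_ord /= -natr1 mulrDl; apply: lerD => //.
  have -> : 1 / 2 = \sum_(b < N) (N + N)%:R^-1 :> R.
    rewrite sumr_const card_ord -[RHS]mulr_natl natrD; field.
    by rewrite -natrD pnatr_eq0 addn_eq0 negb_and -!lt0n N0.
  apply: ler_sum => b _; rewrite lef_pV2 ?posrE ?ltr0n ?addn_gt0 ?N0 //.
  by rewrite ler_nat -addnS leq_add2l.
have [N N0 HN] := H (Num.bound (2 * M)).
exists N => //; apply: lt_le_trans HN.
rewrite ltr_pdivlMr // mulrC.
have [M0|M0] := lerP 0 (2 * M); first exact: archi_boundP.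
by apply: lt_le_trans M0 _; rewrite ler0n.
Qed.

(* If t <= N of the earlier indices are selected, adding the index N costs
   1/sqrt (N + 1) <= 1/sqrt (t + 1) <= 2 (sqrt (t + 1) - sqrt t). *)
Lemma sum_invsqrt_le N (P : pred 'I_N) :
  \sum_(b | P b) (Num.sqrt b.+1%:R)^-1 <= 2 * Num.sqrt (\sum_(b | P b) 1) :> R.
Proof.
elim: N P => [|N IH] P; first by rewrite !big_ord0 mulr_ge0 ?sqrtr_ge0.
rewrite big_mkcond [in leRHS]big_mkcond !big_ord_recr /= -!big_mkcond /=.
have {IH} := IH (fun b => P (widen_ord (leqnSn N) b)).
case: (P ord_max); last by rewrite !addr0.
set t := \sum_(b | _) 1 => IH.
have t0 : 0 <= t by apply: sumr_ge0.
have tN : t <= N%:R.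
  rewrite /t sumr_const ler_nat; apply: leq_trans (max_card _) _.
  by rewrite card_ord.
have st := sqrtr_ge0 t.
have sN : 0 < Num.sqrt (t + 1) by rewrite sqrtr_gt0; lra.
have le_w : (Num.sqrt N.+1%:R)^-1 <= (Num.sqrt (t + 1))^-1 :> R.
  rewrite lef_pV2 ?posrE ?sqrtr_gt0 ?ltr0n //.
    by rewrite ler_wsqrtr // -natr1 lerD2r.
  by rewrite ltr_wpDl.
have e1 := sqr_sqrtr t0.
have e2 : Num.sqrt (t + 1) ^+ 2 = t + 1 by rewrite sqr_sqrtr //; lra.
set a := Num.sqrt t in st e1 IH *; set b := Num.sqrt (t + 1) in sN le_w e2 *.
(* Multiplied by [b], with b^2 = a^2 + 1, this reads (b - a)^2 >= 0. *)
have : b^-1 <= 2 * (b - a).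
  rewrite -div1r ler_pdivrMr //.
  have : 0 <= (b - a) ^+ 2 by apply: sqr_ge0.
  nra.
lra.
Qed.

End Harmonic.

(** * The block matrix and its Gram matrix *)

Section Example.
Variables (R : realType) (m N K : nat).

Let row_idx : finType := (('I_m * 'I_N) + 'I_K)%type.

(** Pairs index the rows of the first block, ['I_K] those of the second. [sigma] is the scale of the
    second block; [sigma = 0] gives the truncated matrix. *)
Definition entry (sigma : R) (t : row_idx) (l : 'I_(m + K)) : R :=
  match t with
  | inl (a, b) => (l == lshift K a)%:R / Num.sqrt b.+1%:R
  | inr c => (l == rshift m c)%:R * sigma
  end.

Definition example sigma : 'M[R]_(#|{: row_idx}|, m + K) :=
  \matrix_(i, l) entry sigma (enum_val i) l.

Let H : R := harmonic_sum R N.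

Lemma sum_rows (P : pred row_idx) (F : row_idx -> R) :
  \sum_(i < #|{: row_idx}| | P (enum_val i)) F (enum_val i) =
    \sum_a \sum_(b | P (inl (a, b))) F (inl (a, b)) + \sum_(c | P (inr c)) F (inr c).
Proof.
rewrite (reindex (@enum_rank row_idx)) /=; last exact/onW_bij/enum_rank_bij.
under eq_bigl do rewrite enum_rankK.
under eq_bigr do rewrite enum_rankK.
rewrite big_sumType /=; congr (_ + _).
by rewrite pair_big_dep; apply: eq_big => [[]|[]].
Qed.

(** The exponent is positive so that zero entries drop out; means use exponent 1, norms exponent
    2. *)
Lemma sum_entryl sigma (P : pred row_idx) a e :
  \sum_(i < #|{: row_idx}| | P (enum_val i))
      entry sigma (enum_val i) (lshift K a) ^+ e.+1 =
    \sum_(b | P (inl (a, b))) (Num.sqrt b.+1%:R)^-1 ^+ e.+1.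
Proof.
rewrite (sum_rows P (fun t => entry sigma t (lshift K a) ^+ e.+1)) /=.
rewrite [X in _ + X]big1 => [|c _]; last first.
  by rewrite eq_lrshift mul0r expr0n.
rewrite addr0 (bigD1 a) //= [X in _ + X]big1 => [|a' na]; last first.
  apply: big1 => b _; rewrite (inj_eq (@lshift_inj _ _)) eq_sym (negbTE na).
  by rewrite mul0r expr0n.
by rewrite addr0; apply: eq_bigr => b _; rewrite eqxx mul1r.
Qed.

Lemma sum_entryr sigma (P : pred row_idx) c e :
  \sum_(i < #|{: row_idx}| | P (enum_val i))
      entry sigma (enum_val i) (rshift m c) ^+ e.+1 =
    (P (inr c))%:R * sigma ^+ e.+1.
Proof.
rewrite (sum_rows P (fun t => entry sigma t (rshift m c) ^+ e.+1)) /=.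
rewrite big1 ?add0r => [|a _]; last first.
  by apply: big1 => b _; rewrite eq_rlshift mul0r expr0n.
rewrite big_mkcond (bigD1 c) //= big1 ?addr0 => [|c' nc]; last first.
  rewrite (inj_eq (@rshift_inj _ _)) eq_sym (negbTE nc) mul0r expr0n.
  by case: ifP.
by rewrite eqxx mul1r; case: ifP; rewrite ?mul1r ?mul0r.
Qed.

Lemma sum_sqr_entryl sigma a :
  \sum_(i < #|{: row_idx}|) entry sigma (enum_val i) (lshift K a) ^+ 2 = H.
Proof.
rewrite (sum_entryl sigma xpredT); apply: eq_bigr => b _.
by rewrite exprVn sqr_sqrtr ?ler0n.
Qed.

Lemma sum_sqr_entryr sigma c :
  \sum_(i < #|{: row_idx}|) entry sigma (enum_val i) (rshift m c) ^+ 2 = sigma ^+ 2.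
Proof. by rewrite (sum_entryr sigma xpredT) mul1r. Qed.

Lemma example_norm sigma :
  \sum_i \sum_l example sigma i l ^+ 2 = m%:R * H + K%:R * sigma ^+ 2.
Proof.
rewrite exchange_big big_split_ord /=; congr (_ + _).
  rewrite mulr_natl -[in RHS](card_ord m) -sumr_const; apply: eq_bigr => a _.
  by under eq_bigr do rewrite mxE; apply: sum_sqr_entryl.
rewrite mulr_natl -[in RHS](card_ord K) -sumr_const; apply: eq_bigr => c _.
by under eq_bigr do rewrite mxE; apply: sum_sqr_entryr.
Qed.

Lemma example_gram sigma :
  (example sigma)^T *m example sigma =
    diag_mx (\row_(l < m + K) if (l < m)%N then H else sigma ^+ 2).
Proof.
apply/matrixP => l l'; rewrite !mxE.
under eq_bigr do rewrite !mxE.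
have [<-|nl] := eqVneq l l'.
  under eq_bigr do rewrite -expr2.
  rewrite mulr1n; case: (split_ordP l) => [a ->|c ->] /=.
    by rewrite sum_sqr_entryl.
  by rewrite sum_sqr_entryr.
rewrite mulr0n; apply: big1 => i _.
case: (enum_val i) => [[a b]|c] /=.
  by have [<-|_] := eqVneq l (lshift K a);
    rewrite ?[l' == l]eq_sym ?(negbTE nl) !(mulr0, mul0r).
by have [<-|_] := eqVneq l (rshift m c);
  rewrite ?[l' == l]eq_sym ?(negbTE nl) !(mulr0, mul0r).
Qed.

Lemma example_trunc sigma :
  example sigma *m diag_mx (\row_(l < m + K) (l < m)%:R) = example 0.
Proof.
apply/matrixP => i l; rewrite mul_mx_diag !mxE.
case: (enum_val i) => [[a b]|c] /=.
  by case: eqP => [->|_]; rewrite /= ?mul0r // ltn_ord mulr1.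
by rewrite mulr0; case: eqP => [->|_]; rewrite ?mul0r //= ltnNge leq_addr mulr0.
Qed.

(** * Squared norm captured by a clustering *)

Section Captured.
Variables (k : nat) (f : {ffun 'I_#|{: row_idx}| -> 'I_k}) (sigma : R).
Let c_ j : R := #|fiber f j|%:R.
Let g t := f (enum_rank t).

Lemma g_val i : g (enum_val i) = f i.
Proof. by rewrite /g enum_valK. Qed.

Lemma mean_examplel a j :
  mean (example sigma) f j (lshift K a) =
    (\sum_(b | g (inl (a, b)) == j) (Num.sqrt b.+1%:R)^-1) / c_ j.
Proof.
congr (_ / _); under eq_bigr do rewrite mxE.
under eq_bigl do rewrite -g_val.
exact: (sum_entryl sigma (fun t => g t == j) a 0).
Qed.

Lemma mean_exampler c j :
  mean (example sigma) f j (rshift m c) = (g (inr c) == j)%:R * sigma / c_ j.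
Proof.
congr (_ / _); under eq_bigr do rewrite mxE.
under eq_bigl do rewrite -g_val.
exact: (sum_entryr sigma (fun t => g t == j) c 0).
Qed.

(** A cluster with [t] rows from column [a] captures at most 4t / [c_ j] there, and these counts add
    up to at most [c_ j] over all [a]: each cluster captures at most 4. *)
Lemma capturedl_le :
  \sum_a \sum_j c_ j * mean (example sigma) f j (lshift K a) ^+ 2 <= 4 * k%:R.
Proof.
rewrite exchange_big /= [leRHS]mulrC mulr_natl -[X in _ *+ X](card_ord k).
rewrite -sumr_const; apply: ler_sum => j _.
under eq_bigr do rewrite mean_examplel.
have [c0|c0] := eqVneq (c_ j) 0.
  by rewrite big1 // => a _; rewrite c0 mul0r.
have cp : 0 < c_ j by rewrite lt0r c0 ler0n.
have le_c : \sum_a \sum_(b | g (inl (a, b)) == j) 1 <= c_ j.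
  rewrite /c_ card_fiber; under [leRHS]eq_bigl do rewrite -g_val.
  by rewrite (sum_rows (fun t => g t == j) (fun=> 1)) lerDl sumr_ge0.
apply: (@le_trans _ _ (\sum_a 4 * (\sum_(b | g (inl (a, b)) == j) 1) / c_ j)).
  apply: ler_sum => a _; rewrite expr_div_n [leLHS]mulrC expr2 invfM !mulrA.
  rewrite mulfVK // ler_pM2r ?invr_gt0 //.
  set s := \sum_(b | _) 1.
  have s0 : 0 <= s by apply: sumr_ge0.
  have -> : 4 * s = (2 * Num.sqrt s) ^+ 2 by rewrite exprMn sqr_sqrtr //; ring.
  rewrite -expr2 ler_sqr ?nnegrE ?mulr_ge0 ?sqrtr_ge0 ?sum_invsqrt_le //.
  by apply: sumr_ge0 => b _; rewrite invr_ge0 sqrtr_ge0.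
by rewrite -big_distrl -big_distrr /= ler_pdivrMr // ler_pM2l.
Qed.

(** The common cluster has at least [K] rows, so each of the [K] columns yields at most sigma^2 / K.
    The guard [sigma != 0] lets the truncated matrix be treated under any assignment. *)
Lemma capturedr_le :
    (forall c c', sigma != 0 -> g (inr c) = g (inr c')) ->
  \sum_c \sum_j c_ j * mean (example sigma) f j (rshift m c) ^+ 2 <= sigma ^+ 2.
Proof.
move=> same.
have [s0|s0] := eqVneq sigma 0.
  rewrite big1 ?sqr_ge0 // => c _; apply: big1 => j _.
  by rewrite mean_exampler s0 mulr0 mul0r expr0n mulr0.
apply: (@le_trans _ _ (\sum_(c < K) sigma ^+ 2 / K%:R)); last first.
  rewrite sumr_const card_ord -[leLHS]mulr_natr.
  have [->|K0] := eqVneq K%:R (0 : R); first by rewrite mulr0 sqr_ge0.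
  by rewrite divfK.
apply: ler_sum => c _.
have K0 : (0 < K)%N by apply: leq_ltn_trans (ltn_ord c).
rewrite (bigD1 (g (inr c))) //= big1 ?addr0 => [|j nj]; last first.
  by rewrite mean_exampler eq_sym (negbTE nj) !mul0r expr0n mulr0.
rewrite mean_exampler eqxx mul1r.
have le_K : K%:R <= c_ (g (inr c)).
  rewrite /c_ card_fiber; under [leRHS]eq_bigl do rewrite -g_val.
  rewrite (sum_rows (fun t => g t == g (inr c)) (fun=> 1)).
  rewrite [X in _ + X](eq_bigl xpredT) => [|c']; last first.
    by rewrite (same c' c s0) eqxx.
  by rewrite sumr_const card_ord lerDr sumr_ge0 // => a _; apply: sumr_ge0.
have Kp : 0 < K%:R :> R by rewrite ltr0n.
have cp := lt_le_trans Kp le_K.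
rewrite expr_div_n [leLHS]mulrC [c_ _ ^+ 2]expr2 invfM !mulrA mulfVK ?gt_eqF //.
by rewrite ler_wpM2l ?sqr_ge0 // lef_pV2.
Qed.

Lemma kcost_example_ge :
    (forall c c', sigma != 0 -> g (inr c) = g (inr c')) ->
  m%:R * H + K%:R * sigma ^+ 2 - 4 * k%:R - sigma ^+ 2 <= kcost (example sigma) f.
Proof.
move=> same; rewrite kcost_captured example_norm big_split_ord /=.
have := capturedl_le; have := capturedr_le same; rewrite /c_; lra.
Qed.

End Captured.

Definition example_clustering : {ffun 'I_#|{: row_idx}| -> 'I_K.+1} :=
  [ffun i => match enum_val i with
             | inl _ => ord_max
             | inr c => lift ord_max c
             end].

Lemma example_clustering_onto : (0 < m)%N -> (0 < N)%N -> onto example_clustering.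
Proof.
move=> m0 N0; apply/ontoP => j; case: (unliftP ord_max j) => [c|] ->.
  by exists (enum_rank (inr c : row_idx)); rewrite ffunE enum_rankK.
exists (enum_rank (inl (Ordinal m0, Ordinal N0) : row_idx)).
by rewrite ffunE enum_rankK.
Qed.

Lemma kcost_example_clustering sigma :
  kcost (example sigma) example_clustering <= m%:R * H.
Proof.
(* Center 0 for the first block and the row itself for each singleton leave only the norm of the
   first block. *)
pose mu (j : 'I_K.+1) l : R :=
  if unlift ord_max j is Some c then entry sigma (inr c) l else 0.
apply: le_trans (kcost_le_wcss _ _ mu) _.
have -> : m%:R * H = \sum_i \sum_l example 0 i l ^+ 2.
  by rewrite example_norm expr0n mulr0 addr0.
apply: ler_sum => i _; apply: ler_sum => l _.
rewrite /mu ffunE !mxE; case: (enum_val i) => [ab|c].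
  by rewrite unlift_none subr0 /entry; case: ab.
by rewrite liftK subrr expr0n sqr_ge0.
Qed.

End Example.

(** * The example with squared singular values [H] and [H - 1] *)

Section Gap.
Variables (R : realType) (m N K : nat).
Hypothesis m_gt0 : (0 < m)%N.
Let H : R := harmonic_sum R N.
Hypotheses (H_gt1 : 1 < H) (H_gtk : 4 * K.+1%:R < H).
Let sigma := Num.sqrt (H - 1).
Let A : 'M[R]_(_, m + K) := example m N K sigma.

Lemma sqr_sigma : sigma ^+ 2 = H - 1.
Proof. by rewrite sqr_sqrtr // subr_ge0 ltW. Qed.

Lemma example_truncated_svd_exists : exists Am, truncated_svd m A Am.
Proof.
apply: truncated_svd_exists (example_gram _ _ _ _) => [j|i j le_ij]; rewrite !mxE.
  by rewrite sqr_sigma; case: ifP => _; move: H_gt1; rewrite /H; lra.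
rewrite sqr_sigma -/H; case: ltnP => [lt_jm|_].
  by rewrite (leq_ltn_trans le_ij lt_jm).
by case: ifP => _; rewrite // gerBl ler01.
Qed.

Lemma example_truncated_svd Am : truncated_svd m A Am -> Am = example m N K 0.
Proof.
move=> Am_svd; rewrite -(example_trunc m N K sigma).
apply: (@truncated_svd_two_values _ _ _ _ _ _ (H - 1)) => //.
- by rewrite subr_gt0.
- exact: leq_addr.
rewrite example_gram sqr_sigma; congr diag_mx; apply/rowP => j; rewrite !mxE -/H.
by case: ifP => _; rewrite ?addr0 // subrK.
Qed.

Lemma truncated_optimum_kcost_ge (f : {ffun _ -> 'I_K.+1}) :
    onto f ->
    (forall g : {ffun _ -> 'I_K.+1}, onto g ->
      kcost (example m N K (0 : R)) f <= kcost (example m N K (0 : R)) g) ->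
  m%:R * H + K%:R * (H - 1) - 4 * K.+1%:R - (H - 1) <= kcost A f.
Proof.
move=> onto_f opt_f; rewrite -sqr_sigma; apply: kcost_example_ge => c c' _.
apply: optimal_eq_rows onto_f opt_f _ _ => [|l].
  (* At [sigma = 0] every cost is at least mH - 4(K + 1), which is positive. *)
  apply: lt_le_trans (kcost_example_ge _); last by move=> ? ?; rewrite eqxx.
  rewrite expr0n /= mulr0 subr0 addr0 subr_gt0.
  apply: lt_le_trans H_gtk _; rewrite -/H ler_peMl ?ler1n //.
  by rewrite ltW // (lt_trans ltr01).
by rewrite !mxE !enum_rankK /= !mulr0.
Qed.

End Gap.

(** * Choice of the parameters and conclusion *)

Theorem theorem21 (R : realType) (lambda eps : R)
    (hlambda : lambda < 1) (heps : 0 < eps) :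
  exists (n d k : nat) (A : 'M[R]_(n, d)),
    let m := `|Num.ceil (k%:R / eps)|%N in
    (exists (Am : 'M[R]_(n, d)) (Pt Ps : 'M[R]_n),
      [/\ truncated_svd m A Am,
          optimal_cluster_proj k Am Pt
        & optimal_cluster_proj k A Ps]) /\
    (forall (Am : 'M[R]_(n, d)) (Pt Ps : 'M[R]_n),
      truncated_svd m A Am ->
      optimal_cluster_proj k Am Pt ->
      optimal_cluster_proj k A Ps ->
      kmeans_cost A Pt > (1 + eps) * lambda * kmeans_cost A Ps).
Proof.
(* A nonnegative bound on [lambda] keeps the later multiplications monotone. *)
pose lam := Num.max lambda 0.
have lam_lt1 : lam < 1 by rewrite gt_max hlambda ltr01.
have lam_ge : lambda <= lam by rewrite le_max lexx.
have lam_ge0 : 0 <= lam by rewrite le_max lexx orbT.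
(* Since m eps >= K + 1, this makes m (1 + eps)(1 - lam) exceed eps + 2. *)
pose K := Num.bound (eps * (eps + 2) / ((1 + eps) * (1 - lam))).
have gap_gt0 : 0 < (1 + eps) * (1 - lam) by rewrite mulr_gt0 //; lra.
have K_gt : eps * (eps + 2) / ((1 + eps) * (1 - lam)) < K%:R.
  apply: archi_boundP; apply: divr_ge0; last exact: ltW.
  by rewrite mulr_ge0 //; lra.
set m := `|Num.ceil (K.+1%:R / eps)|%N.
have q_gt0 : 0 < K.+1%:R / eps by rewrite divr_gt0 ?ltr0n.
have mE : m%:R = (Num.ceil (K.+1%:R / eps))%:~R :> R.
  by rewrite /m natr_absz ger0_norm // ceil_ge0 (lt_trans _ q_gt0) ?ltrN10.
have m_ge : K.+1%:R / eps <= m%:R by rewrite mE ceil_ge.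
have m_lt : m%:R < K.+1%:R / eps + 1.
  by have := ceilB1_lt (K.+1%:R / eps); rewrite mE intrD; lra.
have m_gt0 : (0 < m)%N by rewrite -(ltr_nat R); apply: lt_le_trans m_ge.
(* The coefficient of [H] in the lower bound for the truncated optimum minus (1 + eps) lam m H; the
   remaining terms are -(5K + 3). *)
pose G := m%:R + K%:R - 1 - (1 + eps) * lam * m%:R.
have G_gt0 : 0 < G.
  (* By the ceiling, K + 1 > (m - 1) eps, so [G] exceeds m (1 + eps)(1 - lam) - (eps + 2). *)
  have mu : (m%:R - 1) * eps < K.+1%:R by rewrite -ltr_pdivlMr //; lra.
  have ml : K.+1%:R <= m%:R * eps by rewrite -ler_pdivrMr.
  have Kg : eps * (eps + 2) < K%:R * ((1 + eps) * (1 - lam)).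
    by rewrite -ltr_pdivrMr.
  have : eps * (eps + 2) < (m%:R * eps) * ((1 + eps) * (1 - lam)).
    apply: lt_le_trans Kg _; rewrite ler_pM2r //; apply: le_trans ml.
    by rewrite ler_nat.
  rewrite -[_ * eps * _]mulrA [_ * (eps * _)]mulrCA ltr_pM2l // => h.
  move: mu; rewrite /G -[K.+1%:R]natr1; lra.
(* The three summands secure H G > 5K + 3, H > 4(K + 1) and H > 1. *)
have [N N_gt0 H_gt] := harmonic_unbounded ((5 * K%:R + 3) / G + 4 * K.+1%:R + 1).
have K_ge0 : 0 <= K%:R :> R by rewrite ler0n.
have quo_ge0 : 0 <= (5 * K%:R + 3) / G by rewrite divr_ge0 ?ltW //; lra.
have kk_ge0 : 0 <= K.+1%:R :> R by rewrite ler0n.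
set H := harmonic_sum R N in H_gt.
have H_gt1 : 1 < H by lra.
have H_gtk : 4 * K.+1%:R < H by lra.
have HG : 5 * K%:R + 3 < H * G by rewrite -ltr_pdivrMr //; lra.
exists _, _, K.+1, (example m N K (Num.sqrt (H - 1))); rewrite -/m /=.
have onto_ex := example_clustering_onto K m_gt0 N_gt0.
split.
  have [Am Am_svd] := example_truncated_svd_exists m K H_gt1.
  have [Pt Pt_opt] := optimal_cluster_proj_exists Am onto_ex.
  have [Ps Ps_opt] := optimal_cluster_proj_exists
    (example m N K (Num.sqrt (H - 1))) onto_ex.
  by exists Am, Pt, Ps.
move=> Am Pt Ps /(example_truncated_svd H_gt1) -> /optimal_cluster_projP.
case=> f [onto_f -> opt_f] /optimal_cluster_projP[g [onto_g -> opt_g]].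
rewrite !kmeans_cost_proj_of.
have := truncated_optimum_kcost_ge m_gt0 H_gt1 H_gtk onto_f opt_f.
apply: lt_le_trans.
have := le_trans (opt_g _ onto_ex) (kcost_example_clustering _ _ _ _).
have := kcost_ge0 (example m N K (Num.sqrt (H - 1))) g.
set cost := kcost _ g => cost_ge0 cost_le.
apply: (@le_lt_trans _ _ ((1 + eps) * lam * (m%:R * H))).
  have e1 : 0 <= 1 + eps by lra.
  apply: (@le_trans _ _ ((1 + eps) * lam * cost)).
    by rewrite ler_wpM2r // ler_wpM2l.
  by rewrite ler_wpM2l // mulr_ge0.
rewrite -/H; move: HG; rewrite /G -[K.+1%:R]natr1; lra.
Qed.
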